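(* Let $m$ be an integer with $1\le m\le d-2$, let $\alpha\in(0,1)$, and let $X\subseteq\mathbb{S}^{d-1}$ be a spherical projection of a set of equiangular lines in $\mathbb{R}^d$ with inner product set $A=\{\pm\alpha\}$. Let $G$ be a fixed $m\times m$ proper Gram matrix. Below, $\mathbf{u},\mathbf{v}$ range over the vectors in $\{\pm\alpha\}^m$ whose first coordinates satisfy $u_1=\alpha$, $v_1=\alpha$, and $e_{\mathbf{1}}$ together with the $e_{\mathbf{u}}$ (for $\mathbf u\in\{\pm\alpha\}^m$, $u_1=\alpha$) denote standard basis vectors. Then $$\begin{aligned} \mathcal{Q}^{d, m}_0[G; X] :={}& N_{m-2}[G]\,e_{\mathbf{1}}e_{\mathbf{1}}^{\top} + \sum_{u_1 = \alpha}N_{m-1}[G; \mathbf{u}]\,(e_{\mathbf{1}}e_{\mathbf{u}}^{\top} + e_{\mathbf{u}}e_{\mathbf{1}}^{\top} + e_{\mathbf{u}}e_{\mathbf{u}}^{\top}) \\ &+ \sum_{u_1 = v_1 = \alpha}\left(N_m[G; \mathbf{u}, \mathbf{v}, \alpha] + N_m[G; \mathbf{u}, \mathbf{v}, -\alpha]\right)e_{\mathbf{u}}e_{\mathbf{v}}^{\top} \end{aligned}$$ is positive semidefinite, and for every integer $k \geq 1$, $$\begin{aligned} \mathcal{Q}^{d, m}_k[G; X] :={}& \sum_{u_1 = \alpha} N_{m-1}[G; \mathbf{u}]\,Q^{d, m}_k(G; \mathbf{u}, \mathbf{u}, 1)\,e_{\mathbf{u}}e_{\mathbf{u}}^{\top}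 \\ &+ \sum_{u_1 = v_1 = \alpha}\left(N_m[G; \mathbf{u}, \mathbf{v}, \alpha]\,Q^{d, m}_k(G; \mathbf{u}, \mathbf{v}, \alpha) + N_m[G; \mathbf{u}, \mathbf{v}, -\alpha]\,Q^{d, m}_k(G; \mathbf{u}, \mathbf{v}, -\alpha)\right)e_{\mathbf{u}}e_{\mathbf{v}}^{\top} \end{aligned}$$ is positive semidefinite.
   Context: A set of lines through the origin in $\mathbb{R}^d$ is equiangular if any two distinct lines form the same angle. A spherical projection of a finite set of equiangular lines is a set $X\subseteq\mathbb{S}^{d-1}$ obtained by choosing one unit vector along each line; it satisfies $c\cdot c'=\pm\alpha$ for all distinct $c,c'\in X$. Put $N=|X|$. A proper $m\times m$ Gram matrix is a positive definite symmetric matrix with diagonal entries $1$ and off-diagonal entries in $\{\pm\alpha\}$. For column vectors $\mathbf{u},\mathbf{v}$ and a scalar $t$, write $$(G;\mathbf{u})=\begin{pmatrix} G&\mathbf{u}\\ \mathbf{u}^\top&1\end{pmatrix},\qquad (G;\mathbf{u},\mathbf{v},t)=\begin{pmatrix} G & \mathbf{u} & \mathbf{v}\\ \mathbf{u}^\top & 1 & t\\ \mathbf{v}^\top & t & 1\end{pmatrix}.$$ Two symmetric matrices $M_1,M_2$ are switching equivalent, $M_1\sim M_2$, if $M_2=\Lambda M_1\Lambda$ for some diagonal matrix $\Lambda$ with diagonal entries $\pm1$. For $\mathbf{u},\mathbf{v}\in\{\pm\alpha\}^m$ and $t\in\{\pm\alpha\}$: $N_m[G;\mathbf{u},\mathbf{v},t]$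 is the number of $(b_1,\dots,b_m,c,c')\in X^{m+2}$ whose Gram matrix (matrix of pairwise inner products in this order) is switching equivalent to $(G;\mathbf{u},\mathbf{v},t)$; $N_{m-1}[G;\mathbf{u}]$ is the number of $(b_1,\dots,b_m,c)\in X^{m+1}$ whose Gram matrix is switching equivalent to $(G;\mathbf{u})$; $N_{m-2}[G]$ is the number of $(b_1,\dots,b_m)\in X^m$ whose Gram matrix is switching equivalent to $G$. $\mathcal{Q}^{d,m}_0[G;X]$ is a matrix of order $2^{m-1}+1$ indexed by $\mathbf{1}$ and the vectors $\mathbf{u}\in\{\pm\alpha\}^m$ with $u_1=\alpha$; for $k\ge1$, $\mathcal{Q}^{d,m}_k[G;X]$ has order $2^{m-1}$, indexed by the vectors $\mathbf{u}\in\{\pm\alpha\}^m$ with $u_1=\alpha$. Gegenbauer polynomials $P^n_k$ ($n\ge2$): $P^n_0(t)=1$, $P^n_1(t)=t$, and $P^n_k(t)=\frac{1}{k+n-3}\big((2k+n-4)\,t\,P^n_{k-1}(t)-(k-1)P^n_{k-2}(t)\big)$ for $k\ge2$. Define $$Q^{d,m}_k(G;\mathbf{u},\mathbf{v},t)=(1-\mathbf{u}^\top G^{-1}\mathbf{u})^{k/2}(1-\mathbf{v}^\top G^{-1}\mathbf{v})^{k/2}P^{d-m}_k\left(\frac{t-\mathbf{u}^\top G^{-1}\mathbf{v}}{\sqrt{(1-\mathbf{u}^\top G^{-1}\mathbf{u})(1-\mathbf{v}^\top G^{-1}\mathbf{v})}}\right),$$ which is a polynomial in the entries of $\mathbf{u},\mathbf{v}$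 and $t$ (because $P^{d-m}_k$ has the parity of $k$) and is evaluated as such. *)

(* Defs.v *)
From HB Require Import structures.
From mathcomp Require Import all_boot all_order all_algebra finmap.
From mathcomp Require Import reals trigo.

Set Implicit Arguments.
Unset Strict Implicit.
Unset Printing Implicit Defensive.

Import Order.TTheory GRing.Theory Num.Theory.
Local Open Scope ring_scope.

Section EquiangularLines.
Variables (R : realType) (d : nat).
Implicit Types (x y : 'cV[R]_d) (l : {vspace 'cV[R]_d}).
Implicit Types (L : {fset {vspace 'cV[R]_d}}) (X : {fset 'cV[R]_d}).

Definition dotp x y : R := (x^T *m y) 0 0.

(* [vpick l] is an arbitrary nonzero vector of [l]; on lines, the absolute value
   makes the angle independent of this choice. *)
Definition line_angle l1 l2 : R :=
  let x := vpick l1 in let y := vpick l2 in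
  acos (`|dotp x y| / (Num.sqrt (dotp x x) * Num.sqrt (dotp y y))).

Definition equiangular L : Prop :=
  (forall l, l \in L -> \dim l = 1%N) /\
  exists theta : R,
    forall l1 l2, l1 \in L -> l2 \in L -> l1 != l2 -> line_angle l1 l2 = theta.

Definition spherical_projection L X : Prop :=
  exists f : {vspace 'cV[R]_d} -> 'cV[R]_d,
    (forall l, l \in L -> f l \in l /\ dotp (f l) (f l) = 1) /\
    X = [fset f l | l in L]%fset.

Definition gram n (b : 'I_n -> 'cV[R]_d) : 'M[R]_n :=
  \matrix_(i, j) dotp (b i) (b j).

End EquiangularLines.

Section Matrices.
Variable R : realType.

Definition posdef n (M : 'M[R]_n) : Prop :=
  M^T = M /\ forall x : 'cV[R]_n, x != 0 -> 0 < (x^T *m M *m x) 0 0.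

Definition possemidef n (M : 'M[R]_n) : Prop :=
  M^T = M /\ forall x : 'cV[R]_n, 0 <= (x^T *m M *m x) 0 0.

Definition proper_gram (alpha : R) m (G : 'M[R]_m) : Prop :=
  [/\ posdef G, forall i, G i i = 1
    & forall i j, i != j -> G i j = alpha \/ G i j = - alpha].

Definition signs_mx n (s : {ffun 'I_n -> bool}) : 'M[R]_n :=
  diag_mx (\row_i (-1) ^+ s i).

Definition switching_equiv n (M1 M2 : 'M[R]_n) : bool :=
  [exists s : {ffun 'I_n -> bool}, M2 == signs_mx s *m M1 *m signs_mx s].

Definition border1 m (G : 'M[R]_m) (u : 'cV[R]_m) : 'M[R]_(m + 1) :=
  block_mx G u u^T 1%:M.

Definition border2 m (G : 'M[R]_m) (u v : 'cV[R]_m) (t : R) :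
    'M[R]_(m + (1 + 1)) :=
  block_mx G (row_mx u v) (col_mx u^T v^T) (block_mx 1%:M t%:M t%:M 1%:M).

(* The number of [n]-tuples of points of [X] whose Gram matrix is switching
   equivalent to [M]; [N_m], [N_(m-1)] and [N_(m-2)] are the cases where [M] is
   [border2 G u v t], [border1 G u] and [G]. *)
Definition gram_count d (X : {fset 'cV[R]_d}) n (M : 'M[R]_n) : nat :=
  #|[set b : {ffun 'I_n -> X} | switching_equiv M (gram (fun i => val (b i)))]|.

End Matrices.

Section Gegenbauer.
Variable R : realType.

Fixpoint gegenbauer (n k : nat) : {poly R} :=
  match k with
  | 0 => 1
  | S k1 =>
    match k1 with
    | 0 => 'X
    | S k2 =>
      (k%:R + n%:R - 3)^-1 *:
        ((2 * k%:R + n%:R - 4) *: ('X * gegenbauer n k1)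
         - (k%:R - 1) *: gegenbauer n k2)
    end
  end.

(* The polynomial [w ^ (k / 2) * P^n_k (s / sqrt w)] in [s] and [w]: only the
   monomials of degree [i] congruent to [k] mod 2 occur in [P^n_k]. *)
Definition gegenbauer_hom (n k : nat) (s w : R) : R :=
  \sum_(i < k.+1) (gegenbauer n k)`_i * s ^+ i * w ^+ (k - i)./2.

Definition residual m (G : 'M[R]_m) (u v : 'cV[R]_m) (t : R) : R :=
  t - (u^T *m invmx G *m v) 0 0.

Definition Qpol (d m k : nat) (G : 'M[R]_m) (u v : 'cV[R]_m) (t : R) : R :=
  gegenbauer_hom (d - m) k (residual G u v t)
    (residual G u u 1 * residual G v v 1).

Lemma gegenbauer_size n k : (size (gegenbauer n k) <= k.+1)%N.
Proof.
suff: (size (gegenbauer n k) <= k.+1)%N /\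
      (size (gegenbauer n k.+1) <= k.+2)%N by case.
elim: k => [|k [IH1 IH2]]; first by rewrite size_poly1 size_polyX.
split=> //=; apply: (leq_trans (size_scale_leq _ _)).
apply: (leq_trans (size_polyD _ _)); rewrite size_polyN geq_max.
apply/andP; split; apply: (leq_trans (size_scale_leq _ _)).
  by apply: (leq_trans (size_polyMleq _ _)); rewrite size_polyX.
by apply: (leq_trans IH1); rewrite leqW.
Qed.

Lemma gegenbauer_parity n k i :
  odd (k + i) -> (gegenbauer n k)`_i = 0.
Proof.
suff: forall i, (odd (k + i) -> (gegenbauer n k)`_i = 0) /\
   (odd (k.+1 + i) -> (gegenbauer n k.+1)`_i = 0) by move=> /(_ i) [].
elim: k => [|k IH] {}i.
  by split; [rewrite coefC; case: i|rewrite coefX; case: i => [|[|i]]].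
split; first by case: (IH i).
move=> odd_ki; rewrite [gegenbauer n _.+2]/= coefZ coefB !coefZ coefXM.
have -> : (gegenbauer n k)`_i = 0.
  by apply: (IH i).1; move: odd_ki; rewrite !addSn /= negbK.
case: i odd_ki => [|i] odd_ki /=; first by rewrite !mulr0 subr0 mulr0.
rewrite -[X in _ * X - _]/((gegenbauer n k.+1)`_i) (IH i).2 ?mulr0 ?subr0 ?mulr0 //.
by move: odd_ki; rewrite !addSn !addnS /= !negbK.
Qed.

Lemma gegenbauer_homE n k (s a b : R) : 0 < a -> 0 < b ->
  gegenbauer_hom n k s (a * b) =
  Num.sqrt a ^+ k * Num.sqrt b ^+ k
    * (gegenbauer n k).[s / Num.sqrt (a * b)].
Proof.
move=> a0 b0; have ab0 : 0 < a * b by rewrite mulr_gt0.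
rewrite -exprMn -sqrtrM ?ltW //; set r := Num.sqrt (a * b).
have r0 : r != 0 by rewrite gt_eqF // sqrtr_gt0.
rewrite -{1}(sqr_sqrtr (ltW ab0)) -/r.
rewrite (horner_coef_wide _ (gegenbauer_size n k)) mulr_sumr.
apply: eq_bigr => i _; have ik : (i <= k)%N by rewrite -ltnS.
case: (boolP (odd (k + i))) => [odd_ki|even_ki].
  by rewrite gegenbauer_parity // !mul0r mulr0.
rewrite -exprM mul2n halfK oddB // -oddD (negbTE even_ki) subn0.
have -> : r ^+ k = r ^+ (k - i) * r ^+ i by rewrite -exprD subnK.
rewrite exprMn exprVn [RHS]mulrACA [X in _ = _ * X]mulrCA.
by rewrite mulfV ?expf_neq0 // mulr1 -[RHS]mulrA [RHS]mulrC.
Qed.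

Lemma QpolE d m k (G : 'M[R]_m) (u v : 'cV[R]_m) (t : R) :
  0 < residual G u u 1 -> 0 < residual G v v 1 ->
  Qpol d k G u v t =
  Num.sqrt (residual G u u 1) ^+ k * Num.sqrt (residual G v v 1) ^+ k
    * (gegenbauer (d - m) k).[residual G u v t /
        Num.sqrt (residual G u u 1 * residual G v v 1)].
Proof. exact: gegenbauer_homE. Qed.

End Gegenbauer.

(* A sign pattern [s] encodes the vector of entries [(-1) ^ s_i * alpha]. The
   condition forces the first entry to be [alpha]. *)
Definition uindex (m : nat) : finType :=
  {s : {ffun 'I_m -> bool} | [forall i : 'I_m, (val i == 0%N) ==> ~~ s i]}.

Lemma card_uindex m : (0 < m)%N -> #|uindex m| = (2 ^ m.-1)%N.
Proof.
case: m => // m _; rewrite card_sig.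
pose F (i : 'I_m.+1) : pred bool := [pred b | (val i == 0%N) ==> ~~ b].
rewrite (@eq_card _ _ (family F)); last first.
  by move=> s; rewrite [LHS]inE; apply/forallP/familyP => h i;
     have := h i; rewrite !inE.
rewrite card_family foldrE big_map big_enum /= big_ord_recl /=.
have -> : #|F ord0| = 1%N by rewrite -(card1 false); apply: eq_card; case.
rewrite mul1n (eq_bigr (fun=> 2%N)) ?prod_nat_const ?card_ord // => i _.
by rewrite -card_bool; apply: eq_card.
Qed.

Section QMatrices.
Variables (R : realType) (d m : nat) (alpha : R).
Variables (G : 'M[R]_m) (X : {fset 'cV[R]_d}).

Definition uvec (u : uindex m) : 'cV[R]_m := \col_i ((-1) ^+ val u i * alpha).

Definition basis_vec (T : finType) (t : T) : 'cV[R]_#|T| :=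
  delta_mx (enum_rank t) 0.

Definition basis_prod (T : finType) (s t : T) : 'M[R]_#|T| :=
  basis_vec s *m (basis_vec t)^T.

(* [None] is the index written [1] (bold) and [Some u] is the index [u]. *)
Definition calQ0 : 'M[R]_#|{: option (uindex m)}| :=
  let e := @basis_prod (option (uindex m)) in
  (gram_count X G)%:R *: e None None
  + \sum_(u : uindex m) (gram_count X (border1 G (uvec u)))%:R *:
      (e None (Some u) + e (Some u) None + e (Some u) (Some u))
  + \sum_(u : uindex m) \sum_(v : uindex m)
      ((gram_count X (border2 G (uvec u) (uvec v) alpha))%:R
       + (gram_count X (border2 G (uvec u) (uvec v) (- alpha)))%:R) *:
      e (Some u) (Some v).

Definition calQ (k : nat) : 'M[R]_#|uindex m| :=
  let e := @basis_prod (uindex m) in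
  \sum_(u : uindex m)
    ((gram_count X (border1 G (uvec u)))%:R
     * Qpol d k G (uvec u) (uvec u) 1) *: e u u
  + \sum_(u : uindex m) \sum_(v : uindex m)
      ((gram_count X (border2 G (uvec u) (uvec v) alpha))%:R
         * Qpol d k G (uvec u) (uvec v) alpha
       + (gram_count X (border2 G (uvec u) (uvec v) (- alpha)))%:R
         * Qpol d k G (uvec u) (uvec v) (- alpha)) *:
      e u v.

End QMatrices.

(* Main.v *)
Require Import Defs.
From mathcomp Require Import all_boot all_order all_algebra finmap reals.
From mathcomp Require Import zify ring lra.
From mathcomp Require Import mpoly.

(** Fix a tuple [b] of points of [X] whose Gram matrix is switching equivalent
    to [G], and flip signs so that the Gram matrix becomes [G] itself.  Flip
    every [c] in [X] so that its inner product with the first point of the tuple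
    is [alpha] if possible, and record the inner products of the flipped [c] with
    the whole tuple as its coordinates.  All off-diagonal entries being nonzero,
    the signs realizing a switching are unique up to a global one; hence a
    bordered tuple [(b, c)] or [(b, c, e)] is counted at [u], or at [u, v, t], iff
    [c] and [e] have coordinates [u] and [v] and the flipped points have inner
    product [t] ([switches_border1], [switches_border2]).  So the contribution of
    [b] to the matrix is
      [sum_(c, e) 1_(c at u) 1_(e at v) w(u, v, <c, e>)]
    ([switches_kernel]), the terms [c = e] being exactly the ones in
    [N_(m-1)[G; u]].  For [k = 0] the weight [w] is [1] and this, extended by the
    index [None], is a matrix of rank one.  For [k >= 1] let [U c] be the
    coordinates of the projection of [c] on the orthogonal complement of the
    tuple, which has dimension [d - m] ([complement_projection_factor]).  The
    residuals are the inner products of these projections, so the weight is the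
    degree [k] homogenized Gegenbauer kernel on [R^(d - m)] evaluated at [U c] and
    [U e], and the claim reduces to Schoenberg's theorem that this kernel is
    positive semidefinite ([zonal_kernel_psd]).

    Schoenberg's theorem is proved algebraically, without spherical integrals.
    In variables [X_i, Y_i] let [H_k] be the kernel in dimension [n], a
    polynomial in [S = sum X_i Y_i], [P = sum X_i^2] and [Q = sum Y_i^2].  If
    [H_k] is a sum of products [F(X) F(Y)] then so is
      [sum_i (N X_i - P d/dX_i) (N Y_i - Q d/dY_i) H_k],
    because the two factors act on [X] alone and on [Y] alone, in the same way.
    For [N = 2 k + n - 2] this operator multiplies harmonic polynomials by a
    coordinate and projects the product, up to the factor [N], to harmonic
    polynomials of the next degree; for [k >= 1] the result is a positive multiple
    of [H_(k+1)] ([raise_zonal]).  Induction on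
    [k] writes every [H_k] as a sum of squares ([zonal_sum_of_squares]).  The
    identities for the derivatives of [H_k] all follow from the three-term
    recurrence by the Leibniz rule. *)

Set Implicit Arguments.
Unset Strict Implicit.
Unset Printing Implicit Defensive.

Import Order.TTheory GRing.Theory Num.Theory.
Local Open Scope ring_scope.

(** * Positive semidefinite kernels on finite types *)

(** Indexing by the elements of a finite type rather than by their ranks keeps
    sign patterns and points of [X] usable as indices. *)
Definition psd_kernel {R : numDomainType} {T : finType} (K : T -> T -> R) :=
  (forall s t, K s t = K t s) /\
  forall z : T -> R, 0 <= \sum_s \sum_t K s t * (z s * z t).

Section PsdKernels.
Variable R : realType.

Lemma psd_kernel_eq (T : finType) (K1 K2 : T -> T -> R) :
  K1 =2 K2 -> psd_kernel K1 -> psd_kernel K2.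
Proof.
move=> eqK [symK psdK]; split=> [s t|z]; first by rewrite -!eqK.
rewrite (eq_bigr (fun s => \sum_t K1 s t * (z s * z t))) ?psdK // => s _.
by apply: eq_bigr => t _; rewrite eqK.
Qed.

Lemma psd_kernel_sum (I T : finType) (K : I -> T -> T -> R) :
  (forall i, psd_kernel (K i)) -> psd_kernel (fun s t => \sum_i K i s t).
Proof.
move=> psdK; split=> [s t|z].
  by apply: eq_bigr => i _; rewrite (psdK i).1.
rewrite (eq_bigr (fun s => \sum_i \sum_t K i s t * (z s * z t))).
  by rewrite exchange_big; apply: sumr_ge0 => i _; apply: (psdK i).2.
by move=> s _; rewrite exchange_big; apply: eq_bigr => t _; rewrite mulr_suml.
Qed.

Lemma psd_kernel_pullback (S T : finType) (f : S -> T -> R) (K : S -> S -> R) :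
  psd_kernel K ->
  psd_kernel (fun u v => \sum_c \sum_e f c u * f e v * K c e).
Proof.
move=> [symK psdK]; split=> [u v|z].
  rewrite exchange_big; apply: eq_bigr => c _; apply: eq_bigr => e _.
  by rewrite symK [f e u * _]mulrC.
have := psdK (fun c => \sum_u f c u * z u).
congr (0 <= _); rewrite [RHS]pair_bigA [LHS]pair_bigA /=.
rewrite (eq_bigr (fun ce => \sum_(uv : T * T)
   f ce.1 uv.1 * f ce.2 uv.2 * K ce.1 ce.2 * (z uv.1 * z uv.2))).
  rewrite exchange_big; apply: eq_bigr => -[u v] _ /=.
  by rewrite -mulr_suml pair_bigA.
move=> [c e] _ /=; rewrite big_distrlr pair_bigA mulr_sumr.
by apply: eq_bigr => uv _ /=; ring.
Qed.

Lemma psd_kernel_rank1 (T : finType) (f : T -> R) :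
  psd_kernel (fun u v => f u * f v).
Proof.
split=> [u v|z]; first exact: mulrC.
suff -> : \sum_u \sum_v f u * f v * (z u * z v) = (\sum_u f u * z u) ^+ 2.
  exact: sqr_ge0.
rewrite expr2 big_distrlr; apply: eq_bigr => u _; apply: eq_bigr => v _.
by rewrite mulrACA.
Qed.

Lemma possemidef_kernel (T : finType) (K : T -> T -> R) :
  psd_kernel K -> possemidef (\sum_s \sum_t K s t *: basis_prod R s t).
Proof.
move=> [symK psdK]; split=> [|x].
  rewrite raddf_sum exchange_big; apply: eq_bigr => s _.
  rewrite raddf_sum; apply: eq_bigr => t _.
  by rewrite /= linearZ /= /basis_prod trmx_mul trmxK symK.
have := psdK (fun s => x (enum_rank s) 0).
congr (0 <= _); rewrite mulmx_sumr mulmx_suml summxE; apply: eq_bigr => s _.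
rewrite mulmx_sumr mulmx_suml summxE; apply: eq_bigr => t _.
rewrite -scalemxAr -scalemxAl mxE; congr (_ * _).
rewrite /basis_prod /basis_vec trmx_delta !mulmxA -colE -mulmxA -rowE.
by rewrite mxE big_ord1 !mxE.
Qed.
End PsdKernels.

(** * Three-term recurrence of the homogenized Gegenbauer polynomials *)

Section ZonalRecurrence.
Variables (R : realType) (A : comAlgType R).

(** [gegenbauer_hom] with values in an algebra, so that [s] and [w] can be
    polynomials that are differentiated. *)
Definition zonal (n k : nat) (s w : A) : A :=
  \sum_(i < k.+1) (gegenbauer R n k)`_i *: (s ^+ i * w ^+ (k - i)./2).

Lemma zonal0 n s w : zonal n 0 s w = 1.
Proof. by rewrite /zonal big_ord1 /= coefC /= scale1r mulr1. Qed.

Lemma zonal1 n s w : zonal n 1 s w = s.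
Proof.
by rewrite /zonal big_ord_recl big_ord1 /= !coefX /= scale0r add0r scale1r mulr1.
Qed.

(** The recurrence is shifted to dimension [p + 2] and cleared of denominators,
    so that its coefficients are natural numbers and survive in any algebra. *)
Lemma zonal_rec p k s w :
  (k.+1 + p)%:R * zonal p.+2 k.+2 s w =
  (2 * k.+1 + p)%:R * s * zonal p.+2 k.+1 s w
  - k.+1%:R * w * zonal p.+2 k s w.
Proof.
set c1 : R := (k.+1 + p)%:R; set c2 : R := (2 * k.+1 + p)%:R.
have c1n0 : c1 != 0 by rewrite pnatr_eq0.
have coefE i : (gegenbauer R p.+2 k.+2)`_i = c1^-1 *
    (c2 * ('X * gegenbauer R p.+2 k.+1)`_i - k.+1%:R * (gegenbauer R p.+2 k)`_i).
  rewrite [gegenbauer _ _ k.+2]/= coefZ coefB !coefZ.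
  have -> : k.+2%:R + p.+2%:R - 3 = c1.
    by rewrite /c1; rewrite -[k.+2]addn2 -[p.+2]addn2 -[k.+1]addn1 !natrD; ring.
  have -> : 2 * k.+2%:R + p.+2%:R - 4 = c2.
    by rewrite /c2 -[k.+2]addn2 -[p.+2]addn2 -[k.+1]addn1 !(natrD, natrM); ring.
  by have -> : k.+2%:R - 1 = k.+1%:R :> R by rewrite -addn1 natrD addrK.
have shift : \sum_(i < k.+3) ('X * gegenbauer R p.+2 k.+1)`_i *:
    (s ^+ i * w ^+ (k.+2 - i)./2) = s * zonal p.+2 k.+1 s w.
  rewrite big_ord_recl coefXM /= scale0r add0r /zonal mulr_sumr.
  apply: eq_bigr => i _; rewrite coefXM /= -scalerAr mulrA -exprS.
  by rewrite /bump /= add1n subSS.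
(* The two extra terms vanish because the degree of [gegenbauer n k] is at most
   [k]; in the others lowering [k] by 2 costs one factor [w]. *)
have widen : \sum_(i < k.+3) (gegenbauer R p.+2 k)`_i *:
    (s ^+ i * w ^+ (k.+2 - i)./2) = w * zonal p.+2 k s w.
  rewrite 2!big_ord_recr /= !nth_default ?(leq_trans (gegenbauer_size _ _ _)) //.
  rewrite !scale0r !addr0 /zonal mulr_sumr; apply: eq_bigr => i _.
  have -> : (k.+2 - i)./2 = (k - i)./2.+1 by have ik := ltn_ord i; rewrite /=; lia.
  by rewrite -scalerAr mulrCA -exprS.
have -> : zonal p.+2 k.+2 s w =
    c1^-1 *: (c2 *: (s * zonal p.+2 k.+1 s w) - k.+1%:R *: (w * zonal p.+2 k s w)).
  rewrite -shift -widen !scaler_sumr -sumrB scaler_sumr; apply: eq_bigr => i _.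
  by rewrite coefE !scalerA -scalerBl scalerA.
rewrite -!scaler_nat -/c1 -/c2 -!scalerAl !mul1r scalerA divff // scale1r.
by [].
Qed.
End ZonalRecurrence.

(** * Derivations and polynomials in two points *)

(** Partial derivatives and the vector fields built from them obey the same
    identities, which are therefore proved for any such map. *)
Definition derivation {A : comPzRingType} (D : A -> A) :=
  (forall f g, D (f + g) = D f + D g) /\
  (forall f g, D (f * g) = D f * g + f * D g).

Section Derivations.
Variables (A : comPzRingType) (D : A -> A).
Hypothesis derD : derivation D.
Let derA f g : D (f + g) = D f + D g. Proof. exact: derD.1. Qed.
Let derM f g : D (f * g) = D f * g + f * D g. Proof. exact: derD.2. Qed.

Lemma derivation0 : D 0 = 0.
Proof. by apply: (addrI (D 0)); rewrite -derA !addr0. Qed.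

Lemma derivation1 : D 1 = 0.
Proof. by apply: (addrI (D 1)); rewrite addr0 -{3}(mulr1 1) derM mulr1 mul1r. Qed.

Lemma derivationN f : D (- f) = - D f.
Proof. by apply: (addrI (D f)); rewrite -derA !subrr derivation0. Qed.

Lemma derivation_natl a f : D (a%:R * f) = a%:R * D f.
Proof.
elim: a => [|a IH]; first by rewrite !mul0r derivation0.
by rewrite -addn1 natrD !mulrDl derA IH !mul1r.
Qed.

Lemma derivation_sum (I : finType) (F : I -> A) : D (\sum_i F i) = \sum_i D (F i).
Proof. exact: (big_morph D derA derivation0). Qed.
End Derivations.

Lemma derivation_sum_scaled (A : comPzRingType) (I : finType) (a : I -> A)
    (D : I -> A -> A) :
  (forall i, derivation (D i)) -> derivation (fun f => \sum_i a i * D i f).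
Proof.
move=> derD; split=> f g.
  by rewrite -big_split; apply: eq_bigr => i _; rewrite (derD i).1 mulrDr.
rewrite mulr_suml mulr_sumr -big_split; apply: eq_bigr => i _.
by rewrite (derD i).2 /=; ring.
Qed.

Lemma mderiv_derivation n (R : comNzRingType) (i : 'I_n) :
  derivation (@mderiv n R i).
Proof. by split=> f g; [exact: mderivD|exact: mderivM]. Qed.

Section TwoPointPolynomials.
Variables (R : realType) (n : nat).
Local Notation M := {mpoly R[n + n]}.
Implicit Types f g : M.

(** The first [n] variables are the coordinates of one point, the last [n] those
    of the other. *)
Definition Xv (i : 'I_n) : M := 'X_(lshift n i).
Definition Yv (i : 'I_n) : M := 'X_(rshift n i).
Definition dX (i : 'I_n) : M -> M := mderiv (lshift n i).
Definition dY (i : 'I_n) : M -> M := mderiv (rshift n i).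
Definition Sxy : M := \sum_i Xv i * Yv i.
Definition Pxx : M := \sum_i Xv i ^+ 2.
Definition Qyy : M := \sum_i Yv i ^+ 2.
Definition Wxy : M := Pxx * Qyy.

Lemma dX_derivation i : derivation (dX i).
Proof. exact: mderiv_derivation. Qed.
Lemma dY_derivation i : derivation (dY i).
Proof. exact: mderiv_derivation. Qed.

Lemma mderiv_var (i j : 'I_(n + n)) : mderiv i ('X_j : M) = (i == j)%:R.
Proof.
rewrite mderivX mnm1E eq_sym; case: eqP => [->|_]; last by rewrite scale0r.
by rewrite -{1}(add0m U_(j)%MM) addmK scale1r mpolyX0.
Qed.

Lemma dX_Xv i j : dX i (Xv j) = (i == j)%:R.
Proof. by rewrite /dX mderiv_var eq_lshift. Qed.
Lemma dX_Yv i j : dX i (Yv j) = 0.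
Proof. by rewrite /dX mderiv_var eq_lrshift. Qed.
Lemma dY_Xv i j : dY i (Xv j) = 0.
Proof. by rewrite /dY mderiv_var eq_rlshift. Qed.
Lemma dY_Yv i j : dY i (Yv j) = (i == j)%:R.
Proof. by rewrite /dY mderiv_var eq_rshift. Qed.

Lemma sum_delta (i : 'I_n) (F : 'I_n -> M) : \sum_j (i == j)%:R * F j = F i.
Proof.
rewrite (bigD1 i) //= eqxx mul1r big1 ?addr0 // => j.
by rewrite eq_sym => /negbTE ->; rewrite mul0r.
Qed.

Lemma dX_S i : dX i Sxy = Yv i.
Proof.
rewrite (derivation_sum (dX_derivation i)) -[RHS]sum_delta; apply: eq_bigr => j _.
by rewrite !(dX_derivation i).2 dX_Xv dX_Yv mulr0 addr0.
Qed.
Lemma dY_S i : dY i Sxy = Xv i.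
Proof.
rewrite (derivation_sum (dY_derivation i)) -[RHS]sum_delta; apply: eq_bigr => j _.
by rewrite !(dY_derivation i).2 dY_Xv dY_Yv mul0r add0r mulrC.
Qed.
Lemma dX_P i : dX i Pxx = 2 * Xv i.
Proof.
rewrite (derivation_sum (dX_derivation i)) -[Xv i]sum_delta mulr_sumr; apply: eq_bigr => j _.
by rewrite !(dX_derivation i).2 dX_Xv; ring.
Qed.
Lemma dY_P i : dY i Pxx = 0.
Proof.
rewrite (derivation_sum (dY_derivation i)) big1 // => j _.
by rewrite !(dY_derivation i).2 dY_Xv mul0r mulr0 addr0.
Qed.
Lemma dX_Q i : dX i Qyy = 0.
Proof.
rewrite (derivation_sum (dX_derivation i)) big1 // => j _.
by rewrite !(dX_derivation i).2 dX_Yv mul0r mulr0 addr0.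
Qed.
Lemma dY_Q i : dY i Qyy = 2 * Yv i.
Proof.
rewrite (derivation_sum (dY_derivation i)) -[Yv i]sum_delta mulr_sumr; apply: eq_bigr => j _.
by rewrite !(dY_derivation i).2 dY_Yv; ring.
Qed.
Lemma dX_W i : dX i Wxy = 2 * Xv i * Qyy.
Proof. by rewrite /Wxy (dX_derivation i).2 dX_P dX_Q mulr0 addr0. Qed.
Lemma dY_W i : dY i Wxy = 2 * Yv i * Pxx.
Proof. by rewrite /Wxy (dY_derivation i).2 dY_P dY_Q; ring. Qed.

(** On a reproducing kernel of harmonic polynomials this operator returns a
    multiple of the kernel of one degree less. *)
Definition mixed_laplacian f : M := \sum_i dX i (dY i f).

Lemma mixed_laplacianM f g :
  mixed_laplacian (f * g) = mixed_laplacian f * g + f * mixed_laplacian g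
    + \sum_i (dX i f * dY i g + dY i f * dX i g).
Proof.
rewrite /mixed_laplacian mulr_suml mulr_sumr -!big_split.
apply: eq_bigr => i _ /=.
by rewrite (dY_derivation i).2 (dX_derivation i).1 !(dX_derivation i).2; ring.
Qed.

Lemma mixed_laplacianD f g :
  mixed_laplacian (f + g) = mixed_laplacian f + mixed_laplacian g.
Proof.
rewrite /mixed_laplacian -big_split; apply: eq_bigr => i _.
by rewrite (dY_derivation i).1 (dX_derivation i).1.
Qed.

Lemma mixed_laplacian_natl a f :
  mixed_laplacian (a%:R * f) = a%:R * mixed_laplacian f.
Proof.
rewrite /mixed_laplacian mulr_sumr; apply: eq_bigr => i _.
by rewrite (derivation_natl (dY_derivation i))
           (derivation_natl (dX_derivation i)).
Qed.

Lemma mixed_laplacianN f : mixed_laplacian (- f) = - mixed_laplacian f.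
Proof.
rewrite /mixed_laplacian -sumrN; apply: eq_bigr => i _.
by rewrite (derivationN (dY_derivation i)) (derivationN (dX_derivation i)).
Qed.

Lemma mixed_laplacian_S : mixed_laplacian Sxy = n%:R.
Proof.
rewrite /mixed_laplacian (eq_bigr (fun=> 1)) ?sumr_const ?card_ord //.
by move=> i _; rewrite dY_S dX_Xv eqxx.
Qed.

Lemma mixed_laplacian_W : mixed_laplacian Wxy = 4 * Sxy.
Proof.
rewrite /mixed_laplacian /Sxy mulr_sumr; apply: eq_bigr => i _.
rewrite dY_W (dX_derivation i).2 dX_P (derivation_natl (dX_derivation i)) dX_Yv.
ring.
Qed.

Lemma XdY_derivation : derivation (fun f => \sum_i Xv i * dY i f).
Proof. by apply: derivation_sum_scaled => i; apply: dY_derivation. Qed.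
Lemma YdX_derivation : derivation (fun f => \sum_i Yv i * dX i f).
Proof. by apply: derivation_sum_scaled => i; apply: dX_derivation. Qed.
Lemma XdX_derivation : derivation (fun f => \sum_i Xv i * dX i f).
Proof. by apply: derivation_sum_scaled => i; apply: dX_derivation. Qed.
Lemma YdY_derivation : derivation (fun f => \sum_i Yv i * dY i f).
Proof. by apply: derivation_sum_scaled => i; apply: dY_derivation. Qed.

End TwoPointPolynomials.

(** * Differential identities of the zonal polynomials *)

Section ZonalDerivatives.
Variables (R : realType) (p : nat).
Local Notation n := p.+2.
Local Notation M := {mpoly R[n + n]}.
Local Notation S := (Sxy R n).
Local Notation W := (Wxy R n).

Definition zonalM (k : nat) : M := zonal n k S W.
Local Notation H := zonalM.

Lemma zonalM_rec k :
  (k.+1 + p)%:R * H k.+2 =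
  (2 * k.+1 + p)%:R * S * H k.+1 - k.+1%:R * W * H k.
Proof. exact: zonal_rec. Qed.

Lemma natrM_inj a (f g : M) : a.+1%:R * f = a.+1%:R * g -> f = g.
Proof.
rewrite -!scaler_nat -!scalerAl !mul1r => /(scalerI _); apply.
by rewrite pnatr_eq0.
Qed.

(** Applied to [D = sum X_i d/dY_i], which turns one [Y] into an [X]: then
    [T = P], and dually for [Q].  The shape [D W = 2 S T] is what makes the three
    terms of the recurrence recombine into a single [H] of lower degree. *)
Lemma derivation_zonal (D : M -> M) (T : M) :
  derivation D -> D S = T -> D W = 2 * S * T ->
  forall k, D (H k) = k%:R * T * H k.-1.
Proof.
move=> derD DS DW k.
suff: D (H k) = k%:R * T * H k.-1 /\ D (H k.+1) = k.+1%:R * T * H k by case.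
elim: k => [|k [IH1 IH2]].
  by rewrite /H zonal0 zonal1 (derivation1 derD) DS; split; ring.
split=> //; apply: (@natrM_inj (k + p)).
rewrite -addSn -(derivation_natl derD) zonalM_rec.
rewrite derD.1 (derivationN derD) -[_ * S * _]mulrA -[_ * W * _]mulrA !(derivation_natl derD).
rewrite (derD.2 S) (derD.2 W) IH1 IH2 DS DW.
case: k {IH1 IH2} => [|k] /=; first by rewrite /H zonal0 zonal1; ring.
apply/eqP; rewrite -subr_eq0.
rewrite (_ : _ - _ = - (k.+2%:R * T) *
  ((k.+1 + p)%:R * H k.+2 - ((2 * k.+1 + p)%:R * S * H k.+1 - k.+1%:R * W * H k))); last by ring.
by rewrite zonalM_rec subrr mulr0.
Qed.

(** Applied to the two Euler fields: [H_k] has degree [k] in [X] and in [Y]. *)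
Lemma euler_zonal (D : M -> M) :
  derivation D -> D S = S -> D W = 2 * W ->
  forall k, D (H k) = k%:R * H k.
Proof.
move=> derD DS DW k.
suff: D (H k) = k%:R * H k /\ D (H k.+1) = k.+1%:R * H k.+1 by case.
elim: k => [|k [IH1 IH2]].
  by rewrite /H zonal0 zonal1 (derivation1 derD) DS; split; ring.
split=> //; apply: (@natrM_inj (k + p)).
rewrite -addSn -(derivation_natl derD) mulrCA zonalM_rec.
rewrite derD.1 (derivationN derD) -[_ * S * _]mulrA -[_ * W * _]mulrA !(derivation_natl derD).
by rewrite (derD.2 S) (derD.2 W) IH1 IH2 DS DW; ring.
Qed.

Lemma XdY_S : \sum_i Xv R i * dY i S = Pxx R n.
Proof. by apply: eq_bigr => i _; rewrite dY_S expr2. Qed.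
Lemma YdX_S : \sum_i Yv R i * dX i S = Qyy R n.
Proof. by apply: eq_bigr => i _; rewrite dX_S expr2. Qed.
Lemma XdX_S : \sum_i Xv R i * dX i S = S.
Proof. by apply: eq_bigr => i _; rewrite dX_S. Qed.
Lemma YdY_S : \sum_i Yv R i * dY i S = S.
Proof. by apply: eq_bigr => i _; rewrite dY_S mulrC. Qed.

Lemma XdY_zonal k :
  \sum_i Xv R i * dY i (H k) = k%:R * Pxx R n * H k.-1.
Proof.
apply: (derivation_zonal (XdY_derivation R n)); first exact: XdY_S.
rewrite [in 2 * _]/Sxy mulr_sumr mulr_suml.
by apply: eq_bigr => i _; rewrite dY_W; ring.
Qed.
Lemma YdX_zonal k :
  \sum_i Yv R i * dX i (H k) = k%:R * Qyy R n * H k.-1.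
Proof.
apply: (derivation_zonal (YdX_derivation R n)); first exact: YdX_S.
rewrite [in 2 * _]/Sxy mulr_sumr mulr_suml.
by apply: eq_bigr => i _; rewrite dX_W; ring.
Qed.
Lemma XdX_zonal k : \sum_i Xv R i * dX i (H k) = k%:R * H k.
Proof.
apply: (euler_zonal (XdX_derivation R n)); first exact: XdX_S.
rewrite [RHS]mulrA [2 * _]mulr_sumr mulr_suml.
by apply: eq_bigr => i _; rewrite dX_W; ring.
Qed.
Lemma YdY_zonal k : \sum_i Yv R i * dY i (H k) = k%:R * H k.
Proof.
apply: (euler_zonal (YdY_derivation R n)); first exact: YdY_S.
rewrite [RHS]mulrA [in RHS]/Qyy mulr_sumr.
by apply: eq_bigr => i _; rewrite dY_W; ring.
Qed.

Lemma mixed_laplacian_SM k :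
  mixed_laplacian (S * H k) =
  S * mixed_laplacian (H k) + (2 * k + n)%:R * H k.
Proof.
rewrite mixed_laplacianM mixed_laplacian_S.
rewrite (_ : \sum_i _ = \sum_i Yv R i * dY i (H k) + \sum_i Xv R i * dX i (H k)).
  by rewrite YdY_zonal XdX_zonal; ring.
by rewrite -big_split; apply: eq_bigr => i _; rewrite dX_S dY_S.
Qed.

Lemma mixed_laplacian_WM k :
  mixed_laplacian (W * H k) =
  W * mixed_laplacian (H k) + 4 * S * H k + 4 * k%:R * W * H k.-1.
Proof.
rewrite mixed_laplacianM mixed_laplacian_W.
rewrite (_ : \sum_i _ = 2 * Qyy R n * (\sum_i Xv R i * dY i (H k))
                     + 2 * Pxx R n * (\sum_i Yv R i * dX i (H k))).
  by rewrite YdX_zonal XdY_zonal /Wxy; ring.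
rewrite [2 * Qyy R n * _]mulr_sumr [2 * Pxx R n * _]mulr_sumr -big_split.
by apply: eq_bigr => i _; rewrite dX_W dY_W /=; ring.
Qed.

(** The one second-order fact behind the raising operator.  Carried through the
    product rules for [S] and [W], the recurrence comes out as itself one degree
    lower. *)
Lemma mixed_laplacian_zonal k :
  mixed_laplacian (H k) = (k * (2 * k + p))%:R * H k.-1.
Proof.
suff: mixed_laplacian (H k) = (k * (2 * k + p))%:R * H k.-1 /\
  mixed_laplacian (H k.+1) = (k.+1 * (2 * k.+1 + p))%:R * H k by case.
elim: k => [|k [IH1 IH2]].
  rewrite /H zonal0 zonal1 mixed_laplacian_S; split; last by ring.
  rewrite /mixed_laplacian big1 ?mul0r // => i _.
  by rewrite (derivation1 (dY_derivation _ i)) (derivation0 (dX_derivation _ i)).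
split=> //; apply: (@natrM_inj (k + p)).
rewrite -addSn -mixed_laplacian_natl zonalM_rec.
rewrite mixed_laplacianD mixed_laplacianN -[_ * S * _]mulrA -[_ * W * _]mulrA !mixed_laplacian_natl.
rewrite mixed_laplacian_SM mixed_laplacian_WM IH1 IH2.
case: k {IH1 IH2} => [|k] /=; first by rewrite /H zonal0 zonal1; ring.
apply/eqP; rewrite -subr_eq0.
rewrite (_ : _ - _ = - (k.+2%:R * (2 * k.+2 + n)%:R) *
  ((k.+1 + p)%:R * H k.+2 - ((2 * k.+1 + p)%:R * S * H k.+1 - k.+1%:R * W * H k))); last by ring.
by rewrite zonalM_rec subrr mulr0.
Qed.

(** For [f] harmonic in [X] of degree [k] and [N = 2 k + n - 2], this is [N]
    times the harmonic part of [X_i f]: the Laplacian of [P d/dX_i f] equals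
    [2 N d/dX_i f], and that of [X_i f] equals [2 d/dX_i f]. *)
Definition raiseX (N : nat) (i : 'I_n) (f : M) : M :=
  N%:R * (Xv R i * f) - Pxx R n * dX i f.
Definition raiseY (N : nat) (i : 'I_n) (f : M) : M :=
  N%:R * (Yv R i * f) - Qyy R n * dY i f.

Lemma raise_expand N i f : raiseX N i (raiseY N i f) =
   N%:R ^+ 2 * (Xv R i * Yv R i) * f
   - N%:R * Qyy R n * (Xv R i * dY i f)
   - N%:R * Pxx R n * (Yv R i * dX i f)
   + W * dX i (dY i f).
Proof.
have dXraise : dX i (raiseY N i f) = N%:R * (Yv R i * dX i f) - Qyy R n * dX i (dY i f).
  rewrite /raiseY (dX_derivation _ i).1 (derivationN (dX_derivation _ i)).
  rewrite (derivation_natl (dX_derivation _ i)) ((dX_derivation _ i).2 (Yv R i)).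
  by rewrite ((dX_derivation _ i).2 (Qyy R n)) dX_Q dX_Yv !mul0r !add0r.
by rewrite {1}/raiseX dXraise /raiseY /Wxy; ring.
Qed.

(** The second derivatives enter only through the mixed Laplacian and the first
    derivatives only through the fields [X d/dY] and [Y d/dX], so everything
    collapses to [N (N S H_k - k W H_(k-1))], the right side of the
    recurrence. *)
Lemma raise_zonal k :
  \sum_i raiseX (2 * k + p) i (raiseY (2 * k + p) i (H k)) =
  ((2 * k + p) * (k + p))%:R * H k.+1.
Proof.
set N := (2 * k + p)%N.
rewrite (eq_bigr _ (fun i _ => raise_expand N i _)) big_split !sumrB /=.
rewrite -mulr_suml -[\sum_i N%:R ^+ 2 * _]mulr_sumr -[\sum_i W * _]mulr_sumr.
rewrite -[\sum_i _ * (Xv R i * _)]mulr_sumr -[\sum_i _ * (Yv R i * _)]mulr_sumr.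
rewrite -/(mixed_laplacian (H k)) mixed_laplacian_zonal XdY_zonal YdX_zonal -/(Sxy R n).
rewrite /N.
case: k {N} => [|k] /=; first by rewrite /H zonal0 zonal1 /Wxy; ring.
apply/eqP; rewrite -subr_eq0.
rewrite (_ : _ - _ = - (2 * k.+1 + p)%:R *
  ((k.+1 + p)%:R * H k.+2 - ((2 * k.+1 + p)%:R * S * H k.+1 - k.+1%:R * W * H k))).
  by rewrite zonalM_rec subrr mulr0.
rewrite /Wxy; ring.
Qed.
End ZonalDerivatives.

(** * Zonal polynomials as sums of squares *)

(** Chain rule.  The polynomials for which it holds contain the constants and
    the variables and are closed under sums and products. *)
Lemma derivation_comp_mpoly (R : comNzRingType) (m n : nat)
    (q : m.-tuple {mpoly R[n]}) (D : {mpoly R[n]} -> {mpoly R[n]}) :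
  derivation D -> (forall c, D c%:MP = 0) ->
  forall F : {mpoly R[m]},
    D (F \mPo q) = \sum_j (F^`M(j) \mPo q) * D (tnth q j).
Proof.
move=> derD DC.
pose chain (F : {mpoly R[m]}) := D (F \mPo q) = \sum_j (F^`M(j) \mPo q) * D (tnth q j).
have chainC c : chain c%:MP.
  rewrite /chain comp_mpolyC DC big1 // => j _.
  by rewrite mderivC comp_mpoly0 mul0r.
have chainM F1 F2 : chain F1 -> chain F2 -> chain (F1 * F2).
  rewrite /chain rmorphM /= derD.2 => -> ->.
  rewrite mulr_suml mulr_sumr -big_split; apply: eq_bigr => j _ /=.
  by rewrite mderivM rmorphD !rmorphM /=; ring.
have chainX i : chain 'X_i.
  rewrite /chain comp_mpolyXU -tnth_nth (bigD1 i) //= big1 ?addr0.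
    by rewrite mderivX mnm1E eqxx scale1r -{1}(add0m U_(i)%MM) addmK mpolyX0 rmorph1 mul1r.
  by move=> j; rewrite mderivX mnm1E eq_sym => /negbTE ->; rewrite scale0r comp_mpoly0 mul0r.
elim/mpolyind => [|c mu F _ _ chainF]; first by rewrite -/(chain 0) -mpolyC0.
have chainXm : chain (c *: 'X_[mu]).
  rewrite -mul_mpolyC; apply: (chainM) => //; rewrite mpolyXE_id.
  apply: (big_ind chain) => // [|i _]; first exact: (chainC 1).
  by elim: (mu i) => [|e IH]; [exact: (chainC 1)|rewrite exprS; apply: chainM].
rewrite rmorphD /= derD.1 chainF (chainXm) -big_split; apply: eq_bigr => j _ /=.
by rewrite mderivD rmorphD mulrDl.
Qed.

Section SumsOfSquares.
Variables (R : realType) (p : nat).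
Local Notation n := p.+2.
Local Notation M := {mpoly R[n + n]}.
Local Notation H := (zonalM R p).
Implicit Types F : {mpoly R[n]}.

Definition liftX F : M := F \mPo [tuple Xv R i | i < n].
Definition liftY F : M := F \mPo [tuple Yv R i | i < n].

Lemma dX_liftX i F : dX i (liftX F) = liftX F^`M(i).
Proof.
rewrite (derivation_comp_mpoly _ (dX_derivation R i)); last by move=> c; apply: mderivC.
rewrite (bigD1 i) //= big1 ?addr0.
  by rewrite tnth_mktuple dX_Xv eqxx mulr1.
by move=> j ij; rewrite tnth_mktuple dX_Xv eq_sym (negbTE ij) mulr0.
Qed.
Lemma dY_liftY i F : dY i (liftY F) = liftY F^`M(i).
Proof.
rewrite (derivation_comp_mpoly _ (dY_derivation R i)); last by move=> c; apply: mderivC.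
rewrite (bigD1 i) //= big1 ?addr0.
  by rewrite tnth_mktuple dY_Yv eqxx mulr1.
by move=> j ij; rewrite tnth_mktuple dY_Yv eq_sym (negbTE ij) mulr0.
Qed.
Lemma dX_liftY i F : dX i (liftY F) = 0.
Proof.
rewrite (derivation_comp_mpoly _ (dX_derivation R i)); last by move=> c; apply: mderivC.
by rewrite big1 // => j _; rewrite tnth_mktuple dX_Yv mulr0.
Qed.
Lemma dY_liftX i F : dY i (liftX F) = 0.
Proof.
rewrite (derivation_comp_mpoly _ (dY_derivation R i)); last by move=> c; apply: mderivC.
by rewrite big1 // => j _; rewrite tnth_mktuple dY_Xv mulr0.
Qed.

Definition squares (s : seq {mpoly R[n]}) : M := \sum_(F <- s) liftX F * liftY F.
Definition sum_of_squares (K : M) := exists s, K = squares s.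

(** [raiseX] and [raiseY] on polynomials in a single point. *)
Definition raise (N : nat) (i : 'I_n) F : {mpoly R[n]} :=
  N%:R * ('X_i * F) - (\sum_j 'X_j ^+ 2) * F^`M(i).

Lemma raiseX_liftX N i F : raiseX N i (liftX F) = liftX (raise N i F).
Proof.
have liftU j : liftX 'X_j = Xv R j.
  by rewrite /liftX comp_mpolyXU -tnth_nth tnth_mktuple.
have liftsq : liftX (\sum_j 'X_j ^+ 2) = Pxx R n.
  rewrite /liftX raddf_sum; apply: eq_bigr => j _.
  by rewrite /= rmorphXn /= -/(liftX _) liftU.
rewrite /raiseX dX_liftX -liftU -liftsq /liftX.
by rewrite rmorphB !rmorphM rmorph_nat.
Qed.
Lemma raiseY_liftY N i F : raiseY N i (liftY F) = liftY (raise N i F).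
Proof.
have liftU j : liftY 'X_j = Yv R j.
  by rewrite /liftY comp_mpolyXU -tnth_nth tnth_mktuple.
have liftsq : liftY (\sum_j 'X_j ^+ 2) = Qyy R n.
  rewrite /liftY raddf_sum; apply: eq_bigr => j _.
  by rewrite /= rmorphXn /= -/(liftY _) liftU.
rewrite /raiseY dY_liftY -liftU -liftsq /liftY.
by rewrite rmorphB !rmorphM rmorph_nat.
Qed.

(** [raiseX] sees only the [X] factor and [raiseY] only the [Y] factor. *)
Lemma raiseXY_squares N i F :
  raiseX N i (raiseY N i (liftX F * liftY F)) =
  liftX (raise N i F) * liftY (raise N i F).
Proof.
rewrite -raiseX_liftX -raiseY_liftY.
have -> : raiseY N i (liftX F * liftY F) = liftX F * raiseY N i (liftY F).
  by rewrite /raiseY (dY_derivation _ i).2 dY_liftX mul0r add0r; ring.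
rewrite {1}/raiseX (dX_derivation _ i).2 raiseY_liftY dX_liftY mulr0 addr0 /raiseX.
ring.
Qed.

Lemma raiseY_sum N i (s : seq {mpoly R[n]}) (F : {mpoly R[n]} -> M) :
  raiseY N i (\sum_(f <- s) F f) = \sum_(f <- s) raiseY N i (F f).
Proof.
apply: (big_morph (raiseY N i)) => [f g|]; rewrite /raiseY.
  by rewrite (dY_derivation _ i).1; ring.
by rewrite (derivation0 (dY_derivation _ i)) !mulr0 subr0.
Qed.
Lemma raiseX_sum N i (s : seq {mpoly R[n]}) (F : {mpoly R[n]} -> M) :
  raiseX N i (\sum_(f <- s) F f) = \sum_(f <- s) raiseX N i (F f).
Proof.
apply: (big_morph (raiseX N i)) => [f g|]; rewrite /raiseX.
  by rewrite (dX_derivation _ i).1; ring.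
by rewrite (derivation0 (dX_derivation _ i)) !mulr0 subr0.
Qed.

Lemma sum_of_squares_raise N K :
  sum_of_squares K -> sum_of_squares (\sum_i raiseX N i (raiseY N i K)).
Proof.
case=> s ->; exists [seq raise N i F | i <- enum 'I_n, F <- s].
rewrite /squares big_allpairs_dep /= big_enum /=; apply: eq_bigr => i _.
by rewrite raiseY_sum raiseX_sum; apply: eq_bigr => F _; rewrite raiseXY_squares.
Qed.

Lemma sum_of_squaresZ (c : R) K :
  0 <= c -> sum_of_squares K -> sum_of_squares (c *: K).
Proof.
move=> c0 [s ->]; exists [seq Num.sqrt c *: F | F <- s].
rewrite /squares big_map scaler_sumr; apply: eq_bigr => F _.
rewrite /liftX /liftY !comp_mpolyZ -scalerAl -scalerAr scalerA.
by rewrite -expr2 sqr_sqrtr.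
Qed.

(** The induction starts at degree 1, since in dimension 2 the raising operator
    annihilates degree 0. *)
Lemma zonal_sum_of_squares k : sum_of_squares (H k).
Proof.
case: k => [|k].
  by exists [:: 1]; rewrite /squares big_seq1 /liftX /liftY !rmorph1 mulr1 /zonalM zonal0.
elim: k => [|k IH].
  exists [seq 'X_i | i <- enum 'I_n].
  rewrite /zonalM zonal1 /squares big_map big_enum; apply: eq_bigr => i _ /=.
  by rewrite /liftX /liftY !comp_mpolyXU -!tnth_nth !tnth_mktuple.
set c : R := ((2 * k.+1 + p) * (k.+1 + p))%:R.
have c0 : c != 0 by rewrite pnatr_eq0 muln_eq0; lia.
rewrite -[H _](scalerK c0) -/c.
apply: sum_of_squaresZ; first by rewrite invr_ge0 ler0n.
rewrite scaler_nat -mulr_natl -raise_zonal; exact: sum_of_squares_raise.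
Qed.

End SumsOfSquares.

Section Dot.
Variables (R : realType) (d : nat).
Implicit Types x y : 'cV[R]_d.

Lemma dotpZl a x y : dotp (a *: x) y = a * dotp x y.
Proof. by rewrite /dotp linearZ /= -scalemxAl mxE. Qed.
Lemma dotpZr a x y : dotp x (a *: y) = a * dotp x y.
Proof. by rewrite /dotp -scalemxAr mxE. Qed.
Lemma dotpC x y : dotp x y = dotp y x.
Proof. by rewrite /dotp -[in LHS](trmxK y) -trmx_mul mxE. Qed.
End Dot.

(** Schoenberg's theorem, homogenized to cover vectors of every length: a
    projection of a point of [X] may be short, or zero. *)
Lemma zonal_kernel_psd (R : realType) (n k : nat) (T : finType) (x : T -> 'cV[R]_n) :
  (2 <= n)%N ->
  psd_kernel (fun s t => gegenbauer_hom n k (dotp (x s) (x t))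
                           (dotp (x s) (x s) * dotp (x t) (x t))).
Proof.
case: n x => [|[|p]] // x _.
have dotpE (a b : 'cV[R]_p.+2) : dotp a b = \sum_i a i 0 * b i 0.
  by rewrite /dotp mxE; apply: eq_bigr => i _; rewrite mxE.
split=> [s t|z]; first by rewrite dotpC mulrC.
(* The point with [X] coordinates [x s] and [Y] coordinates [x t]. *)
pose v s t (i : 'I_(p.+2 + p.+2)) : R :=
  match split i with inl j => x s j 0 | inr j => x t j 0 end.
have vX s t i : (Xv R i).@[v s t] = x s i 0.
  by rewrite mevalXU /v (unsplitK (inl _ i)).
have vY s t i : (Yv R i).@[v s t] = x t i 0.
  by rewrite mevalXU /v (unsplitK (inr _ i)).
have vS s t : (Sxy R p.+2).@[v s t] = dotp (x s) (x t).
  by rewrite raddf_sum dotpE; apply: eq_bigr => i _; rewrite /= mevalM vX vY.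
have vW s t : (Wxy R p.+2).@[v s t] = dotp (x s) (x s) * dotp (x t) (x t).
  rewrite mevalM !raddf_sum /= !dotpE; congr (_ * _); apply: eq_bigr => i _;
  by rewrite expr2 mevalM ?vX ?vY.
have [sq Hsq] := zonal_sum_of_squares R p k.
have zE s t : gegenbauer_hom p.+2 k (dotp (x s) (x t))
    (dotp (x s) (x s) * dotp (x t) (x t)) =
    \sum_(F <- sq) F.@[fun i => x s i 0] * F.@[fun i => x t i 0].
  transitivity ((zonalM R p k).@[v s t]).
    rewrite /zonalM /zonal raddf_sum; apply: eq_bigr => i _ /=.
    by rewrite mevalZ mevalM !rmorphXn /= vS vW mulrA.
  rewrite Hsq raddf_sum; apply: eq_bigr => F _ /=.
  rewrite mevalM !comp_mpoly_meval; congr (_ * _); apply: meval_eq => i;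
  by rewrite tnth_mktuple ?vX ?vY.
have -> : \sum_s \sum_t gegenbauer_hom p.+2 k (dotp (x s) (x t))
    (dotp (x s) (x s) * dotp (x t) (x t)) * (z s * z t) =
  \sum_(F <- sq) (\sum_s z s * F.@[fun i => x s i 0]) ^+ 2.
  rewrite (eq_bigr (fun s => \sum_(F <- sq) \sum_t
    (z s * F.@[fun i => x s i 0]) * (z t * F.@[fun i => x t i 0]))).
    rewrite exchange_big; apply: eq_bigr => F _ /=.
    by rewrite expr2 big_distrlr.
  move=> s _; rewrite exchange_big; apply: eq_bigr => t _ /=.
  by rewrite zE mulr_suml; apply: eq_bigr => F _; ring.
by apply: sumr_ge0 => F _; apply: sqr_ge0.
Qed.

(** * Factoring the projection onto an orthogonal complement *)

Section Geometry.
Variable R : realType.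

Definition quad n (M : 'M[R]_n) (x : 'cV[R]_n) : R := (x^T *m M *m x) 0 0.

Lemma quad_block n (a : R) (b : 'rV[R]_n) (M : 'M[R]_n) (y : R) (x : 'cV[R]_n) :
  quad (block_mx a%:M b b^T M) (col_mx y%:M x) =
  a * y ^+ 2 + 2 * y * (b *m x) 0 0 + quad M x.
Proof.
rewrite /quad tr_col_mx mul_row_block mul_row_col tr_scalar_mx -trmx_mul.
rewrite !mulmxDl -!scalar_mxM !mul_mx_scalar mul_scalar_mx -!scalemxAl.
set bx := b *m x; set xMx := x^T *m M *m x.
by rewrite !mxE eqxx mulr1n; ring.
Qed.

(** Cholesky factorization, by elimination of the first coordinate.  A zero
    pivot is harmless: its row then vanishes, and so does [r^-1 *: b]. *)
Lemma psd_cholesky n (M : 'M[R]_n) :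
  possemidef M -> exists V : 'M[R]_n, M = V^T *m V.
Proof.
elim: n M => [|n IH] M [symM psdM]; first by exists 0; rewrite !thinmx0.
pose a : R := M 0 0; pose b : 'rV[R]_n := @ursubmx R 1 n 1 n M.
pose M' : 'M[R]_n := @drsubmx R 1 n 1 n M.
have symM' : M'^T = M' by rewrite /M' trmx_drsub symM.
have blockM : M = block_mx a%:M b b^T M' :> 'M_(1 + n).
  rewrite -[LHS](@submxK R 1 n 1 n); congr block_mx.
    rewrite [LHS]mx11_scalar !mxE; congr (M _ _)%:M; exact: val_inj.
  by rewrite /b trmx_ursub symM.
have quadM y x : 0 <= a * y ^+ 2 + 2 * y * (b *m x) 0 0 + quad M' x.
  by rewrite -quad_block -blockM; apply: psdM.
have a_ge0 : 0 <= a by have := quadM 1 0; rewrite /quad !mulmx0 !mxE; lra.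
have b_eq0 : a = 0 -> b = 0.
  move=> a0; apply/rowP => j; rewrite [RHS]mxE.
  set x : 'cV[R]_n := delta_mx j 0.
  have -> : b 0 j = (b *m x) 0 0 by rewrite /x -colE [RHS]mxE.
  apply/eqP/negPn/negP => c0.
  (* With a zero pivot the form is affine in [y], and this [y] gives it the
     value -1. *)
  have := quadM (- (quad M' x + 1) / (2 * (b *m x) 0 0)) x.
  set c := (b *m x) 0 0 in c0 *; set q := quad _ _.
  have -> : a * (- (q + 1) / (2 * c)) ^+ 2 + 2 * (- (q + 1) / (2 * c)) * c + q = - 1.
    by rewrite a0; field.
  by rewrite lerNr oppr0 ler10.
pose r := Num.sqrt a; pose b' := r^-1 *: b.
have rr : r * r = a by rewrite -expr2 sqr_sqrtr.
have rb : r *: b' = b.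
  rewrite /b' scalerA; have [r0|r0] := eqVneq r 0; last by rewrite divff // scale1r.
  by rewrite b_eq0 ?scaler0 // -rr r0 mul0r.
have [V' V'E] : exists V' : 'M[R]_n, M' - b'^T *m b' = V'^T *m V'.
  apply: (IH (M' - b'^T *m b')); split=> [|x].
    by rewrite linearB /= trmx_mul trmxK symM'.
  (* This [y] minimizes the form for given [x]; the minimum is the form of the
     Schur complement. *)
  have := quadM (- ((b' *m x) 0 0 / r)) x.
  rewrite /quad mulmxBr mulmxBl [in X in _ -> X]mxE [(- _ : 'M_1) 0 0]mxE.
  have -> : (x^T *m (b'^T *m b') *m x) 0 0 = ((b' *m x) 0 0) ^+ 2.
    by rewrite mulmxA -trmx_mul -mulmxA mxE big_ord1 !mxE.
  have -> : (b *m x) 0 0 = r * (b' *m x) 0 0 by rewrite -rb -scalemxAl mxE.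
  have [r0|r0] := eqVneq r 0.
    have -> : b' = 0 by rewrite /b' r0 invr0 scale0r.
    by rewrite mul0mx r0 invr0 !mxE; lra.
  rewrite -rr; set c := (b' *m x) 0 0; set q := _ 0 0.
  by have -> : r * r * (- (c / r)) ^+ 2 + 2 * - (c / r) * (r * c) + q = q - c ^+ 2
    by field.
exists (block_mx r%:M b' 0 V' : 'M_(1 + n)).
rewrite blockM.
change (block_mx a%:M b b^T M' =
        (block_mx r%:M b' 0 V')^T *m block_mx r%:M b' 0 V' :> 'M_(1 + n)).
rewrite tr_block_mx mulmx_block.
rewrite trmx0 !mul0mx !mulmx0 !addr0 tr_scalar_mx -scalar_mxM rr mul_scalar_mx rb.
rewrite mul_mx_scalar -V'E addrC subrK; congr block_mx.
by rewrite -rb linearZ.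
Qed.

(** The left side [P] is the orthogonal projection that kills the columns of
    [B].  Its rows lie in a space of dimension [d - m], so [P = U0^T M U0] with
    the rows of [U0] a basis of this space, and [M] is semidefinite because [P]
    is; a Cholesky factor of [M] turns [U0] into [U]. *)
Lemma complement_projection_factor d m (B : 'M[R]_(d, m)) :
  B^T *m B \in unitmx ->
  exists U : 'M[R]_(d - m, d),
    1%:M - B *m invmx (B^T *m B) *m B^T = U^T *m U.
Proof.
set G := B^T *m B => unitG; set P := _ - _.
have symG : (invmx G)^T = invmx G.
  by rewrite trmx_inv; congr invmx; rewrite /G trmx_mul trmxK.
have symP : P^T = P.
  by rewrite /P linearB /= trmx1 !trmx_mul trmxK symG mulmxA.
have PB : P *m B = 0.
  by rewrite /P mulmxBl mul1mx -!mulmxA mulVmx // mulmx1 subrr.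
have idemP : P *m P = P.
  by rewrite {2}/P mulmxBr mulmx1 mulmxA [P *m (_ *m _)]mulmxA PB !mul0mx subr0.
have rankB : \rank B = m.
  apply/eqP; rewrite eqn_leq rank_leq_col /=.
  by rewrite -{1}(mxrank_unit unitG) /G mxrankM_maxr.
have rankK : \rank (kermx B) = (d - m)%N by rewrite mxrank_ker rankB.
rewrite -rankK; set U0 := row_base (kermx B).
have /submxP [D PD] : (P <= U0)%MS by rewrite eq_row_base; apply/sub_kermxP.
have /row_freeP [Z ZE] : row_free U0 by exact: row_base_free.
have PZ : P *m Z *m U0 = P by rewrite PD -[D *m _ *m Z]mulmxA ZE mulmx1.
have PE : P = U0^T *m (Z^T *m P *m Z) *m U0.
  rewrite -!mulmxA [P *m (_ *m _)]mulmxA PZ.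
  by rewrite mulmxA -[LHS]symP -{1}PZ !trmx_mul symP mulmxA.
have psdZ : possemidef (Z^T *m P *m Z).
  split=> [|x]; first by rewrite !trmx_mul trmxK symP mulmxA.
  rewrite -idemP -{1}symP !mulmxA -!trmx_mul -!mulmxA mxE.
  by apply: sumr_ge0 => i _; rewrite mxE -expr2 sqr_ge0.
have [V VE] := psd_cholesky psdZ.
by exists (V *m U0); rewrite {1}PE VE (trmx_mul V U0) !mulmxA.
Qed.

End Geometry.

(** * Switching classes of bordered tuples *)

Section Tuples.
Variable T : finType.

Definition join m n (b : {ffun 'I_m -> T}) (c : {ffun 'I_n -> T}) :
    {ffun 'I_(m + n) -> T} :=
  [ffun i => match split i with inl j => b j | inr j => c j end].

Lemma join_lshift m n b c i : @join m n b c (lshift n i) = b i.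
Proof. by rewrite ffunE (unsplitK (inl _ i)). Qed.
Lemma join_rshift m n b c i : @join m n b c (rshift m i) = c i.
Proof. by rewrite ffunE (unsplitK (inr _ i)). Qed.

Lemma sum_join (V : nmodType) m n (F : {ffun 'I_(m + n) -> T} -> V) :
  \sum_g F g = \sum_b \sum_c F (join b c).
Proof.
rewrite pair_bigA /= (reindex (fun p => @join m n p.1 p.2)) //=.
exists (fun g : {ffun 'I_(m + n) -> T} => ([ffun i => g (lshift n i)], [ffun j => g (rshift m j)])).
  move=> [b c] _ /=; congr (_, _); apply/ffunP => i; rewrite ffunE.
    exact: join_lshift.
  exact: join_rshift.
move=> g _; apply/ffunP => i /=.
by rewrite ffunE; case: (splitP i) => j ij; rewrite ffunE; congr (g _); exact: val_inj.
Qed.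

Lemma sum_ffun1 (V : nmodType) (F : {ffun 'I_1 -> T} -> V) :
  \sum_g F g = \sum_x F [ffun=> x].
Proof.
rewrite (reindex (fun x : T => [ffun=> x] : {ffun 'I_1 -> T})) //=.
exists (fun g : {ffun 'I_1 -> T} => g 0) => [x _|g _]; first by rewrite ffunE.
by apply/ffunP => i; rewrite ffunE ord1.
Qed.
End Tuples.

Section Counting.
Variables (R : realType) (d : nat) (X : {fset 'cV[R]_d}).

Definition switches n (M : 'M[R]_n) (g : {ffun 'I_n -> X}) : bool :=
  switching_equiv M (gram (fun i => val (g i))).

Lemma switchesP n (M : 'M[R]_n) (g : {ffun 'I_n -> X}) :
  reflect (exists s : {ffun 'I_n -> bool}, forall i j,
             dotp (val (g i)) (val (g j)) = (-1) ^+ s i * M i j * (-1) ^+ s j)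
          (switches M g).
Proof.
have entry (s : {ffun 'I_n -> bool}) i j :
    (signs_mx R s *m M *m signs_mx R s) i j = (-1) ^+ s i * M i j * (-1) ^+ s j.
  by rewrite /signs_mx mul_mx_diag mul_diag_mx !mxE.
apply: (iffP existsP) => -[s sP]; exists s.
  by move=> i j; rewrite -entry -(eqP sP) mxE.
by apply/eqP/matrixP => i j; rewrite entry mxE sP.
Qed.

Lemma gram_count_sum n (M : 'M[R]_n) :
  (gram_count X M)%:R = \sum_g (switches M g)%:R :> R.
Proof.
rewrite /gram_count -sum1_card natr_sum big_mkcond; apply: eq_bigr => g _.
by rewrite inE -/(switches M g); case: switches.
Qed.

Lemma gram_count_border1 m (G : 'M[R]_m) u :
  (gram_count X (border1 G u))%:R =
  \sum_b \sum_c (switches (border1 G u) (join b [ffun=> c]))%:R :> R.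
Proof.
rewrite gram_count_sum sum_join; apply: eq_bigr => b _; exact: sum_ffun1.
Qed.

Lemma gram_count_border2 m (G : 'M[R]_m) u v t :
  (gram_count X (border2 G u v t))%:R =
  \sum_b \sum_c \sum_e
    (switches (border2 G u v t) (join b (join [ffun=> c] [ffun=> e])))%:R :> R.
Proof.
rewrite gram_count_sum sum_join; apply: eq_bigr => b _.
by rewrite sum_join sum_ffun1; apply: eq_bigr => c _; rewrite sum_ffun1.
Qed.
End Counting.

Lemma trmx_col_entry (R : Type) (n : nat) (w : 'cV[R]_n) i : w^T 0 i = w i 0.
Proof. by rewrite mxE. Qed.

Lemma mulr_rev3 (R : comPzRingType) (a b c : R) : a * b * c = c * b * a.
Proof. by ring. Qed.

Section SwitchedTuple.
Variables (R : realType) (d m : nat) (alpha : R).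
Variables (X : {fset 'cV[R]_d}) (G : 'M[R]_m) (i0 : 'I_m).
Hypothesis i0E : val i0 = 0%N.
Hypothesis alpha01 : 0 < alpha < 1.
Hypothesis unitX : forall c : X, dotp (val c) (val c) = 1.
Hypothesis anglesX : forall c e : X, c != e ->
  dotp (val c) (val e) = alpha \/ dotp (val c) (val e) = - alpha.
Hypothesis properG : proper_gram alpha G.

Lemma alpha_neq0 : alpha != 0.
Proof. by case/andP: alpha01 => /gt_eqF ->. Qed.

Lemma alpha_neqN : alpha != - alpha.
Proof. by apply/eqP; case/andP: alpha01; lra. Qed.

(** The first coordinate fixes the sign that switching leaves undetermined. *)
Lemma uvec_first (u : uindex m) : uvec alpha u i0 0 = alpha.
Proof.
rewrite mxE; have /forallP /(_ i0) := valP u.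
by rewrite i0E eqxx /= => /negbTE ->; rewrite mul1r.
Qed.

Lemma uvec_inj : injective (@uvec R m alpha).
Proof.
move=> u v uv; apply/val_inj/ffunP => i.
have := congr1 (fun w : 'cV_m => w i 0) uv; rewrite !mxE.
move/(mulIf alpha_neq0); case: (val u i) (val v i) => [] [] //=; lra.
Qed.

Lemma proper_gram_neq0 i j : G i j != 0.
Proof.
have [_ G1 Galpha] := properG.
have [->|ij] := eqVneq i j; first by rewrite G1 oner_neq0.
by case: (Galpha _ _ ij) => ->; rewrite ?oppr_eq0 alpha_neq0.
Qed.

Variables (b : {ffun 'I_m -> X}) (s : {ffun 'I_m -> bool}).
Hypothesis gram_b : forall i j,
  dotp (val (b i)) (val (b j)) = (-1) ^+ s i * G i j * (-1) ^+ s j.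

(** The tuple with its signs changed, as columns, so that its Gram matrix is
    [G]. *)
Definition base : 'M[R]_(d, m) := \matrix_(r, i) ((-1) ^+ s i * val (b i) r 0).

Lemma baseE i y : (base^T *m y) i 0 = (-1) ^+ s i * dotp (val (b i)) y.
Proof.
rewrite /dotp !mxE mulr_sumr; apply: eq_bigr => r _.
by rewrite !mxE mulrA.
Qed.

Lemma gram_base : base^T *m base = G.
Proof.
apply/matrixP => i j.
have -> : (base^T *m base) i j = (base^T *m col j base) i 0.
  by rewrite !mxE; apply: eq_bigr => r _; rewrite !mxE.
rewrite baseE.
have -> : col j base = (-1) ^+ s j *: val (b j).
  by apply/colP => r; rewrite !mxE.
by rewrite dotpZr gram_b; case: (s i) (s j) => [] [] /=; ring.
Qed.

(** Comparing with [s] at an entry [(i, i0)], which is nonzero, shows that [r]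
    and [s] agree at [i] iff they agree at [i0]. *)
Lemma switching_unique (r : 'I_m -> bool) :
  (forall i j, dotp (val (b i)) (val (b j)) = (-1) ^+ r i * G i j * (-1) ^+ r j) ->
  forall i, r i = s i (+) (r i0 (+) s i0).
Proof.
move=> gram_r i; have := gram_r i i0; rewrite gram_b.
rewrite -!mulrA ![G _ _ * _]mulrC !mulrA -!signr_addb => /(mulIf (proper_gram_neq0 i i0)).
by case: (r i) (s i) (r i0) (s i0) => [] [] [] [] //=; lra.
Qed.

(** A point whose inner product with the first base vector is neither [alpha]
    nor [- alpha], such as the first point of the tuple, is flipped too; its
    coordinates then match no [u] and it does not count. *)
Definition flipped (c : X) : bool := (base^T *m val c) i0 0 != alpha.
Definition orient (c : X) : 'cV[R]_d := (-1) ^+ flipped c *: val c.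
Definition coords (c : X) : 'cV[R]_m := base^T *m orient c.

Lemma orient_unique (c : X) (sg : bool) :
  (base^T *m ((-1) ^+ sg *: val c)) i0 0 = alpha -> orient c = (-1) ^+ sg *: val c.
Proof.
rewrite /orient /flipped -scalemxAr mxE; set y := (_ *m _) i0 0.
case: sg => /=; last by rewrite !mul1r => ->; rewrite eqxx.
rewrite mulN1r => ya; suff -> : y != alpha by [].
by apply/eqP => ya'; have := alpha_neqN; rewrite -{1}ya ya' eqxx.
Qed.

Lemma dotp_orient_diag c : dotp (orient c) (orient c) = 1.
Proof. by rewrite dotpZl dotpZr unitX mulr1 -signr_addb addbb. Qed.

Lemma dotp_orient c e : c != e ->
  dotp (orient c) (orient e) = alpha \/ dotp (orient c) (orient e) = - alpha.
Proof.
move=> ce; rewrite dotpZl dotpZr mulrA -signr_addb.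
case: (anglesX ce) => ->; case: (_ (+) _) => /=; rewrite ?mul1r ?mulN1r ?opprK;
by [left|right].
Qed.

(** The signs [s i (+) tau] and [rho] are those of a switching of a bordered
    matrix; of the two choices for [c], the first coordinate selects one. *)
Lemma coords_of_switching (c : X) (tau rho : bool) (u : uindex m) :
  (forall i, dotp (val (b i)) (val c) =
     (-1) ^+ (s i (+) tau) * uvec alpha u i 0 * (-1) ^+ rho) ->
  orient c = (-1) ^+ (tau (+) rho) *: val c /\ coords c = uvec alpha u.
Proof.
move=> dot_bc.
have coordE : base^T *m ((-1) ^+ (tau (+) rho) *: val c) = uvec alpha u.
  apply/colP => i; rewrite -scalemxAr mxE baseE dot_bc !signr_addb.
  by case: (s i) (tau) (rho) => [] [] [] /=; ring.
have orientE : orient c = (-1) ^+ (tau (+) rho) *: val c.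
  by apply: orient_unique; rewrite coordE uvec_first.
by split=> //; rewrite /coords orientE.
Qed.

Lemma dotp_coords (c : X) i :
  dotp (val (b i)) (val c) = (-1) ^+ s i * coords c i 0 * (-1) ^+ flipped c.
Proof.
rewrite /coords /orient -scalemxAr mxE baseE.
by case: (s i) (flipped c) => [] [] /=; ring.
Qed.

Lemma switches_border1 (c : X) (u : uindex m) :
  switches (border1 G (uvec alpha u)) (join b [ffun=> c]) =
  (coords c == uvec alpha u).
Proof.
apply/switchesP/eqP => [[r rP]|coordE].
  pose rl i := r (lshift 1 i).
  have rlE : forall i, rl i = s i (+) (rl i0 (+) s i0).
    apply: switching_unique => i j; have := rP (lshift 1 i) (lshift 1 j).
    by rewrite !join_lshift block_mxEul.
  apply: (@coords_of_switching c (rl i0 (+) s i0) (r (rshift m 0)) u _).2 => i.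
  have := rP (lshift 1 i) (rshift m 0).
  by rewrite join_lshift join_rshift ffunE block_mxEur -/(rl i) rlE.
exists (join s [ffun=> flipped c]) => i j.
case: (split_ordP i) => {}i ->; case: (split_ordP j) => {}j ->;
  rewrite ?join_lshift ?join_rshift ?ffunE.
- by rewrite block_mxEul.
- by rewrite block_mxEur (ord1 j) dotp_coords coordE.
- by rewrite block_mxEdl (ord1 i) trmx_col_entry dotpC dotp_coords coordE mulr_rev3.
- rewrite block_mxEdr !ord1 mxE eqxx unitX mulr1 -signr_addb addbb //.
Qed.

Lemma switches_border2 (c e : X) (u v : uindex m) t :
  switches (border2 G (uvec alpha u) (uvec alpha v) t)
    (join b (join [ffun=> c] [ffun=> e])) =
  [&& coords c == uvec alpha u, coords e == uvec alpha v
    & dotp (orient c) (orient e) == t].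
Proof.
apply/switchesP/and3P => [[r rP]|[/eqP coordc /eqP coorde /eqP dotce]].
  pose rl i := r (lshift (1 + 1) i).
  have rlE : forall i, rl i = s i (+) (rl i0 (+) s i0).
    apply: switching_unique => i j; have := rP (lshift (1 + 1) i) (lshift (1 + 1) j).
    by rewrite !join_lshift block_mxEul.
  set tau := rl i0 (+) s i0 in rlE.
  pose kc := rshift m (lshift 1 (0 : 'I_1)); pose ke := rshift m (rshift 1 (0 : 'I_1)).
  have [orientc coordc] : orient c = (-1) ^+ (tau (+) r kc) *: val c /\
      coords c = uvec alpha u.
    apply: coords_of_switching => i; have := rP (lshift (1 + 1) i) kc.
    by rewrite join_lshift join_rshift join_lshift ffunE block_mxEur row_mxEl -/(rl i) rlE.
  have [oriente coorde] : orient e = (-1) ^+ (tau (+) r ke) *: val e /\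
      coords e = uvec alpha v.
    apply: coords_of_switching => i; have := rP (lshift (1 + 1) i) ke.
    by rewrite join_lshift !join_rshift ffunE block_mxEur row_mxEr -/(rl i) rlE.
  rewrite coordc coorde orientc oriente !eqxx dotpZl dotpZr; split=> //; apply/eqP.
  have := rP kc ke; rewrite !join_rshift join_lshift !ffunE block_mxEdr block_mxEur.
  rewrite mxE eqxx mulr1n => ->.
  by case: (tau) (r kc) (r ke) => [] [] [] /=; ring.
have dotce' : dotp (val c) (val e) = (-1) ^+ flipped c * t * (-1) ^+ flipped e.
  rewrite -dotce /orient dotpZl dotpZr.
  by case: (flipped c) (flipped e) => [] [] /=; ring.
exists (join s (join [ffun=> flipped c] [ffun=> flipped e])) => i j.
case: (split_ordP i) => {}i ->; case: (split_ordP j) => {}j ->;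
  rewrite ?join_lshift ?join_rshift.
- by rewrite block_mxEul.
- rewrite block_mxEur; case: (split_ordP j) => {}j ->;
  rewrite ?join_lshift ?join_rshift !ffunE (ord1 j) ?row_mxEl ?row_mxEr.
    by rewrite dotp_coords coordc.
  by rewrite dotp_coords coorde.
- rewrite block_mxEdl; case: (split_ordP i) => {}i ->;
  rewrite ?join_lshift ?join_rshift !ffunE (ord1 i) ?col_mxEu ?col_mxEd.
    by rewrite trmx_col_entry dotpC dotp_coords coordc mulr_rev3.
  by rewrite trmx_col_entry dotpC dotp_coords coorde mulr_rev3.
- rewrite block_mxEdr; case: (split_ordP i) => {}i ->; case: (split_ordP j) => {}j ->;
  rewrite ?join_lshift ?join_rshift !ffunE !ord1
    ?block_mxEul ?block_mxEur ?block_mxEdl ?block_mxEdr !mxE eqxx mulr1n.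
  + by rewrite unitX mulr1 -signr_addb addbb.
  + exact: dotce'.
  + by rewrite dotpC dotce' mulr_rev3.
  + by rewrite unitX mulr1 -signr_addb addbb.
Qed.

Definition at_coords (c : X) (u : uindex m) : R := (coords c == uvec alpha u)%:R.

(** Off the diagonal the inner product of two flipped points is [alpha] or
    [- alpha], so one of the two counts applies.  On the diagonal it is [1], so
    neither does and the first sum takes over, [uvec] being injective. *)
Lemma switches_kernel (w : uindex m -> uindex m -> R -> R) (u v : uindex m) :
  (u == v)%:R * (\sum_c (switches (border1 G (uvec alpha u)) (join b [ffun=> c]))%:R
                  * w u u 1)
  + \sum_c \sum_e
     ((switches (border2 G (uvec alpha u) (uvec alpha v) alpha)
         (join b (join [ffun=> c] [ffun=> e])))%:R * w u v alpha
      + (switches (border2 G (uvec alpha u) (uvec alpha v) (- alpha))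
         (join b (join [ffun=> c] [ffun=> e])))%:R * w u v (- alpha)) =
  \sum_c \sum_e at_coords c u * at_coords e v * w u v (dotp (orient c) (orient e)).
Proof.
rewrite mulr_sumr -big_split; apply: eq_bigr => c _ /=.
rewrite (bigD1 c) //= [in RHS](bigD1 c) //= addrA; congr (_ + _).
  rewrite !switches_border2 switches_border1 dotp_orient_diag /at_coords.
  have [a0 a1] := andP alpha01.
  rewrite [1 == alpha]gt_eqF // [1 == - alpha]gt_eqF ?andbF; last by lra.
  rewrite !mul0r !addr0; have [->|uv] := eqVneq u v.
    by case: (coords c == _); rewrite ?mul1r ?mul0r.
  case: eqP => [->|_]; rewrite ?mul0r // ?mul1r.
  by rewrite (inj_eq uvec_inj) (negbTE uv) mul0r.
apply: eq_bigr => e; rewrite eq_sym => ce.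
rewrite !switches_border2 /at_coords.
case: (coords c == _); case: (coords e == _); rewrite /= ?mul0r ?mulr0 ?addr0 ?mul0r // !mul1r.
have aN := negbTE alpha_neqN.
case: (dotp_orient ce) => ->; rewrite eqxx.
  by rewrite aN mul1r mul0r addr0.
by rewrite eq_sym aN mul1r mul0r add0r.
Qed.
End SwitchedTuple.

(** * Decomposition of the matrices into tuple kernels *)

Lemma spherical_projection_unit (R : realType) d (L : {fset {vspace 'cV[R]_d}})
    (X : {fset 'cV[R]_d}) :
  spherical_projection L X -> forall c : X, dotp (val c) (val c) = 1.
Proof.
by case=> f [unitf XE] [c /=]; rewrite XE => /imfsetP [l /= lL ->]; case: (unitf l lL).
Qed.

Lemma proper_gram_unit (R : realType) (alpha : R) m (G : 'M[R]_m) :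
  proper_gram alpha G -> G \in unitmx.
Proof.
case=> -[_ posG] _ _; rewrite -row_free_unit -kermx_eq0; apply/eqP/row_matrixP => i.
rewrite row0; apply/eqP/negPn/negP => x0.
have := posG (row i (kermx G))^T; rewrite trmx_eq0 => /(_ x0).
by rewrite trmxK -row_mul mulmx_ker row0 mul0mx mxE ltxx.
Qed.

Section Assembly.
Variables (R : realType) (d m : nat) (alpha : R).
Variables (X : {fset 'cV[R]_d}) (G : 'M[R]_m) (i0 : 'I_m).
Hypothesis i0E : val i0 = 0%N.
Hypothesis alpha01 : 0 < alpha < 1.
Hypothesis unitX : forall c : X, dotp (val c) (val c) = 1.
Hypothesis anglesX : forall c e : X, c != e ->
  dotp (val c) (val e) = alpha \/ dotp (val c) (val e) = - alpha.
Hypothesis properG : proper_gram alpha G.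

(** By this restriction, tuples whose Gram matrix is not in the class of [G]
    contribute nothing. *)
Lemma switches_restrict n (A : 'M[R]_(m, n)) B C (b : {ffun 'I_m -> X}) c :
  switches (block_mx G A B C) (join b c) -> switches G b.
Proof.
case/switchesP => r rP; apply/switchesP; exists [ffun i => r (lshift n i)] => i j.
by have := rP (lshift n i) (lshift n j); rewrite !join_lshift block_mxEul !ffunE.
Qed.

Definition tuple_kernel (w : uindex m -> uindex m -> R -> R)
    (b : {ffun 'I_m -> X}) (u v : uindex m) : R :=
  (u == v)%:R * (\sum_c (switches (border1 G (uvec alpha u)) (join b [ffun=> c]))%:R
                  * w u u 1)
  + \sum_c \sum_e
     ((switches (border2 G (uvec alpha u) (uvec alpha v) alpha)
         (join b (join [ffun=> c] [ffun=> e])))%:R * w u v alpha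
      + (switches (border2 G (uvec alpha u) (uvec alpha v) (- alpha))
         (join b (join [ffun=> c] [ffun=> e])))%:R * w u v (- alpha)).

Lemma switches_borderF (b : {ffun 'I_m -> X}) : ~~ switches G b ->
  (forall u c, switches (border1 G u) (join b [ffun=> c]) = false) /\
  (forall u v t c e,
     switches (border2 G u v t) (join b (join [ffun=> c] [ffun=> e])) = false).
Proof.
move=> /negP notG; split=> [u c|u v t c e]; apply/negbTE/negP;
by rewrite ?/border1 ?/border2 => /switches_restrict.
Qed.

Lemma tuple_kernelF w (b : {ffun 'I_m -> X}) u v :
  ~~ switches G b -> tuple_kernel w b u v = 0.
Proof.
case/switches_borderF => sw1 sw2; rewrite /tuple_kernel.
rewrite [X in _ * X]big1 => [|c _]; last by rewrite sw1 mul0r.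
rewrite mulr0 add0r big1 // => c _.
by rewrite big1 // => e _; rewrite !sw2 !mul0r addr0.
Qed.

Lemma sum_tuple_kernel w u v :
  \sum_b tuple_kernel w b u v =
  (u == v)%:R * ((gram_count X (border1 G (uvec alpha u)))%:R * w u u 1)
  + ((gram_count X (border2 G (uvec alpha u) (uvec alpha v) alpha))%:R * w u v alpha
     + (gram_count X (border2 G (uvec alpha u) (uvec alpha v) (- alpha)))%:R
       * w u v (- alpha)).
Proof.
rewrite [LHS]big_split /= gram_count_border1.
rewrite (gram_count_border2 X G (uvec alpha u) (uvec alpha v) alpha).
rewrite (gram_count_border2 X G (uvec alpha u) (uvec alpha v) (- alpha)).
congr (_ + _).
  rewrite [in RHS]mulr_suml [RHS]mulr_sumr; apply: eq_bigr => b _.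
  by congr (_ * _); rewrite [RHS]mulr_suml.
rewrite [X in _ = X + _]mulr_suml [X in _ = _ + X]mulr_suml -[RHS]big_split.
apply: eq_bigr => b _ /=.
rewrite [X in _ = X + _]mulr_suml [X in _ = _ + X]mulr_suml -[RHS]big_split.
apply: eq_bigr => c _ /=.
by rewrite [X in _ = X + _]mulr_suml [X in _ = _ + X]mulr_suml -[RHS]big_split.
Qed.

Lemma sum_diag (V : lmodType R) (T : finType) (F : T -> R) (E : T -> T -> V) :
  \sum_u F u *: E u u = \sum_u \sum_v ((u == v)%:R * F u) *: E u v.
Proof.
apply: eq_bigr => u _; rewrite (bigD1 u) //= eqxx mul1r big1 ?addr0 // => v.
by rewrite eq_sym => /negbTE ->; rewrite mul0r scale0r.
Qed.

Lemma calQE k :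
  calQ alpha G X k = \sum_u \sum_v
    (\sum_b tuple_kernel (fun u v => Qpol d k G (uvec alpha u) (uvec alpha v)) b u v)
    *: basis_prod R u v.
Proof.
rewrite /calQ sum_diag -big_split; apply: eq_bigr => u _ /=.
rewrite -big_split; apply: eq_bigr => v _ /=.
by rewrite -scalerDl sum_tuple_kernel.
Qed.

Definition tuple_kernel0 (b : {ffun 'I_m -> X}) (s t : option (uindex m)) : R :=
  match s, t with
  | None, None => (switches G b)%:R
  | None, Some u | Some u, None =>
      \sum_c (switches (border1 G (uvec alpha u)) (join b [ffun=> c]))%:R
  | Some u, Some v => tuple_kernel (fun _ _ _ => 1) b u v
  end.

Lemma sum_option (V : nmodType) (T : finType) (F : option T -> V) :
  \sum_s F s = F None + \sum_u F (Some u).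
Proof.
rewrite (bigD1 None) //=; congr (_ + _).
rewrite (reindex_omap Some id) /=; last by case.
by apply: eq_bigl => u; rewrite eqxx.
Qed.

Lemma calQ0E :
  calQ0 alpha G X = \sum_s \sum_t (\sum_b tuple_kernel0 b s t) *: basis_prod R s t.
Proof.
pose N u : R := (gram_count X (border1 G (uvec alpha u)))%:R.
rewrite sum_option sum_option /= -gram_count_sum.
rewrite (eq_bigr (fun u => N u *: basis_prod R None (Some u))); last first.
  by move=> u _; rewrite -gram_count_border1.
rewrite [X in _ = _ + X](eq_bigr (fun u => N u *: basis_prod R (Some u) None +
   \sum_v (\sum_b tuple_kernel (fun _ _ _ => 1) b u v) *: basis_prod R (Some u) (Some v))).
  rewrite /calQ0 [X in _ + X + _ = _](eq_bigr (fun u => N u *: basis_prod R None (Some u) +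
    (N u *: basis_prod R (Some u) None + N u *: basis_prod R (Some u) (Some u)))).
    rewrite !big_split /= -!addrA; congr (_ + (_ + (_ + _))).
    rewrite (sum_diag _ (fun u v => basis_prod R (Some u) (Some v))) -big_split.
    apply: eq_bigr => u _ /=; rewrite -big_split; apply: eq_bigr => v _ /=.
    rewrite -scalerDl; congr (_ *: _); rewrite sum_tuple_kernel.
    by congr (_ * _ + (_ + _)); rewrite [RHS]mulr1.
  by move=> u _; rewrite !scalerDr addrA.
by move=> u _; rewrite sum_option /= -gram_count_border1.
Qed.

Lemma tuple_kernel0_psd b : psd_kernel (tuple_kernel0 b).
Proof.
have [|notG] := boolP (switches G b); last first.
  have [sw1 sw2] := switches_borderF notG.
  apply: (@psd_kernel_eq _ _ (fun _ _ => 0 * 0)); last exact: psd_kernel_rank1.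
  move=> [u|] [v|] /=; rewrite ?(negbTE notG) ?mulr0 //.
  - by rewrite tuple_kernelF.
  - by rewrite big1 // => c _; rewrite sw1.
  - by rewrite big1 // => c _; rewrite sw1.
move=> goodb; have /switchesP [s sP] := goodb.
pose f (t : option (uindex m)) : R :=
  if t is Some u then \sum_c at_coords alpha i0 b s c u else 1.
apply: (@psd_kernel_eq _ _ (fun s t => f s * f t)); last exact: psd_kernel_rank1.
have sumE u : \sum_c (switches (border1 G (uvec alpha u)) (join b [ffun=> c]))%:R =
     \sum_c at_coords alpha i0 b s c u.
  by apply: eq_bigr => c _; rewrite (switches_border1 i0E alpha01 unitX properG sP).
move=> [u|] [v|] /=; rewrite ?mulr1 ?mul1r ?goodb ?sumE //.
rewrite /tuple_kernel (switches_kernel i0E alpha01 unitX anglesX properG sP (fun _ _ _ => 1)).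
by rewrite big_distrlr; apply: eq_bigr => c _; apply: eq_bigr => e _; rewrite mulr1.
Qed.

(** The projections of the flipped points are vectors of [R^(d - m)] whose
    inner products are the residuals, so [Qpol] is the zonal kernel at them. *)
Lemma tuple_kernel_psd k (b : {ffun 'I_m -> X}) : (m <= d - 2)%N -> (0 < m)%N ->
  psd_kernel (tuple_kernel (fun u v => Qpol d k G (uvec alpha u) (uvec alpha v)) b).
Proof.
move=> md m0; have [|notG] := boolP (switches G b); last first.
  apply: (@psd_kernel_eq _ _ (fun _ _ => 0 * 0)); last exact: psd_kernel_rank1.
  by move=> u v; rewrite tuple_kernelF ?mulr0.
case/switchesP => s sP.
have unitG := proper_gram_unit properG.
have gramB := gram_base sP.
have [U UE] : exists U : 'M[R]_(d - m, d),
    1%:M - base b s *m invmx G *m (base b s)^T = U^T *m U.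
  by rewrite -gramB; apply: complement_projection_factor; rewrite gramB.
pose proj c := U *m orient alpha i0 b s c.
have residualE c e u v : coords alpha i0 b s c = u -> coords alpha i0 b s e = v ->
    residual G u v (dotp (orient alpha i0 b s c) (orient alpha i0 b s e)) =
    dotp (proj c) (proj e).
  move=> <- <-; rewrite /residual /dotp /proj (trmx_mul U) !mulmxA.
  rewrite -[_ *m U^T *m U]mulmxA -UE.
  rewrite mulmxBr mulmx1 mulmxBl [RHS]mxE [(- _ : 'M_1) 0 0]mxE; congr (_ - _).
  by rewrite /coords (trmx_mul (base b s)^T) trmxK !mulmxA.
have dm2 : (2 <= d - m)%N by lia.
apply: (@psd_kernel_eq _ _ (fun u v => \sum_c \sum_e
   at_coords alpha i0 b s c u * at_coords alpha i0 b s e v *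
   gegenbauer_hom (d - m) k (dotp (proj c) (proj e))
     (dotp (proj c) (proj c) * dotp (proj e) (proj e)))); last first.
  exact/psd_kernel_pullback/zonal_kernel_psd.
move=> u v; rewrite /tuple_kernel (switches_kernel i0E alpha01 unitX anglesX properG sP
  (fun u v => Qpol d k G (uvec alpha u) (uvec alpha v))).
apply: eq_bigr => c _; apply: eq_bigr => e _; rewrite /at_coords.
case: eqP => [cu|_]; last by rewrite !mul0r.
case: eqP => [ev|_]; last by rewrite mulr0 !mul0r.
rewrite /Qpol (residualE _ _ _ _ cu ev).
rewrite -(residualE _ _ _ _ cu cu) -(residualE _ _ _ _ ev ev).
by rewrite !(dotp_orient_diag _ _ unitX).
Qed.

End Assembly.

Unset Implicit Arguments.

Theorem theorem3p8 (R : realType) (d m : nat) (alpha : R)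
    (L : {fset {vspace 'cV[R]_d}}) (X : {fset 'cV[R]_d}) (G : 'M[R]_m) :
  (1 <= m <= d - 2)%N ->
  0 < alpha < 1 ->
  equiangular L ->
  spherical_projection L X ->
  (forall c c', c \in X -> c' \in X -> c != c' ->
     dotp c c' = alpha \/ dotp c c' = - alpha) ->
  proper_gram alpha G ->
  possemidef (calQ0 alpha G X) /\
  forall k : nat, (1 <= k)%N -> possemidef (calQ alpha G X k).
Proof.
move=> /andP [m_gt0 m_le] alpha01 _ projX anglesX properG.
have unitX := spherical_projection_unit projX.
have anglesX' (c e : X) : c != e ->
    dotp (val c) (val e) = alpha \/ dotp (val c) (val e) = - alpha.
  by move=> ce; apply: anglesX; rewrite ?(valP c) ?(valP e) // (inj_eq val_inj).
pose i0 := Ordinal m_gt0; have i0E : val i0 = 0%N by [].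
split=> [|k _]; rewrite (calQ0E, calQE); apply/possemidef_kernel/psd_kernel_sum => b.
  exact: (tuple_kernel0_psd i0E).
exact: (tuple_kernel_psd i0E).
Qed.
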